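(* Let $n\geq 3$ and $s\geq 1$ be integers with $s^2\equiv 1\pmod n$ and $s\not\equiv 1\pmod n$, let $D_{n,s}=\langle a,b\mid a^n=b^2=1,\ bab^{-1}=a^s\rangle$ and $\tau=\gcd(s-1,n)$. For $0\le k\le \tau-1$ define $$d_{k,1}=\begin{cases}\frac{n+3\tau}{2} & \text{if } k\equiv 0 \pmod{\tau},\\ \frac{\tau}{2} & \text{if } k\not\equiv 0\pmod \tau \text{ and } nk\equiv 0\pmod{\tau^2},\\ 0&\text{otherwise,}\end{cases}\qquad d_{k,2}=\begin{cases}\frac{n-\tau}{2} & \text{if } k\equiv 0 \pmod{\tau},\\ \frac{\tau}{2} & \text{if } k\not\equiv 0\pmod \tau \text{ and } nk\equiv 0\pmod{\tau^2},\\ 0&\text{otherwise,}\end{cases}$$ and for $1\le k\le n-1$ with $k\not\equiv 0\pmod{n/\tau}$ define $d_k=\tau$ if $k\equiv 0\pmod \tau$ and $d_k=0$ otherwise. Then $$T(D_{n,s})\cong\Big(\bigoplus_{k=0}^{\tau-1}M_{d_{k,1}}\Big)\oplus\Big(\bigoplus_{k=0}^{\tau-1}M_{d_{k,2}}\Big)\oplus\Big(\bigoplus_{k} M_{d_k}\Big),$$ where the last sum runs over a set of representatives $k$ of the classes of integers $1\le k\le n-1$ with $k\not\equiv 0\pmod{n/\tau}$ under the identification $k\sim ks \pmod n$ (one term for each pair $\{k,ks \bmod n\}$).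
   Context: $M_d$ denotes the full algebra of $d\times d$ complex matrices, with $M_0=0$. For a finite group $G$ with identity $e$ and conjugacy classes $\mathrm{Cl}_0=\{e\},\dots,\mathrm{Cl}_t$, let $A_i$ be the $|G|\times|G|$ $0/1$-matrix indexed by $G$ with $A_i(x,y)=1$ iff $yx^{-1}\in\mathrm{Cl}_i$, and $E_i^*$ the diagonal matrix with $E_i^*(u,u)=1$ iff $u\in\mathrm{Cl}_i$. The Terwilliger algebra $T(G)$ is the subalgebra of $M_{|G|}(\mathbb{C})$ generated by all $A_i$ and $E_i^*$; the isomorphism is one of $\mathbb{C}$-algebras. *)

(* Defs.v *)
From HB Require Import structures.
From mathcomp Require Import all_boot all_order all_algebra all_fingroup.
From mathcomp Require Import complex reals.

Set Implicit Arguments.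
Unset Strict Implicit.
Unset Printing Implicit Defensive.

Import GRing.Theory.
Local Open Scope ring_scope.

Section MatrixSubalgebras.
Variables (F : fieldType) (N : nat).
Implicit Types (S X : 'M[F]_N -> Prop) (A B : 'M[F]_N).

Definition mx_subalgebra S : Prop :=
  [/\ S 1%:M,
      forall (c : F) A B, S A -> S B -> S (c *: A + B)
    & forall A B, S A -> S B -> S (A *m B)].

Definition mx_generated X : 'M[F]_N -> Prop :=
  fun A => forall S, mx_subalgebra S -> (forall B, X B -> S B) -> S A.

(* The direct sum of the full matrix algebras M_(d i), i : I, is the type of
   families (forall i, 'M_(d i)) with the componentwise operations; 'M_0 is the
   zero algebra. *)
Definition mx_isomorphic S (I : finType) (d : I -> nat) : Prop :=
  exists f : 'M[F]_N -> forall i : I, 'M[F]_(d i),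
  [/\ forall (c : F) A B, S A -> S B ->
        forall i, f (c *: A + B) i = c *: f A i + f B i,
      forall A B, S A -> S B -> forall i, f (A *m B) i = f A i *m f B i,
      forall i, f 1%:M i = 1%:M,
      forall A B, S A -> S B -> (forall i, f A i = f B i) -> A = B
    & forall u : (forall i : I, 'M[F]_(d i)),
        exists2 A, S A & forall i, f A i = u i].

End MatrixSubalgebras.

Section Terwilliger.
Variables (F : fieldType) (gT : finGroupType) (G : {group gT}).

(* Rows and columns of the matrices below are indexed by G through this map. *)
Definition gelt (x : 'I_#|G|) : gT := enum_val x.

Definition class_adj (C : {set gT}) : 'M[F]_#|G| :=
  \matrix_(x, y) (gelt y * (gelt x)^-1 \in C)%g%:R.

Definition class_dual_idem (C : {set gT}) : 'M[F]_#|G| :=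
  \matrix_(x, y) ((x == y) && (gelt x \in C))%:R.

Definition terwilliger : 'M[F]_#|G| -> Prop :=
  mx_generated (fun M => exists2 C, C \in classes G
                           & M = class_adj C \/ M = class_dual_idem C).

End Terwilliger.

Section BlockSizes.
Local Open Scope nat_scope.
Variables n s : nat.

Definition tau := gcdn (s - 1) n.

(* The halvings are exact in all the cases where they are used, provided
   s ^ 2 = 1 %[mod n]. *)
Definition dim1 (k : nat) : nat :=
  if tau %| k then (n + 3 * tau) %/ 2
  else if tau ^ 2 %| n * k then tau %/ 2 else 0.

Definition dim2 (k : nat) : nat :=
  if tau %| k then (n - tau) %/ 2
  else if tau ^ 2 %| n * k then tau %/ 2 else 0.

Definition dim3 (k : nat) : nat := if tau %| k then tau else 0.

Definition krange : {set 'I_n} :=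
  [set k : 'I_n | (0 < k) && ~~ (n %/ tau %| k)].

(* This is an equivalence relation when s ^ 2 = 1 %[mod n]. *)
Definition ksim (k l : 'I_n) : bool := (l == k) || (l == k * s %[mod n]).

Definition kclasses : {set {set 'I_n}} := equivalence_partition ksim krange.

Definition block_index (K : {set 'I_n}) : finType :=
  ('I_tau + 'I_tau + {k : 'I_n | k \in K})%type.

Definition block_dim (K : {set 'I_n}) (i : block_index K) : nat :=
  match i with
  | inl (inl k) => dim1 k
  | inl (inr k) => dim2 k
  | inr k => dim3 (val k)
  end.

End BlockSizes.

(* Main.v *)
Require Import Defs.
From HB Require Import structures.
From mathcomp Require Import all_boot all_order all_algebra all_fingroup.
From mathcomp Require Import all_solvable all_field.
From mathcomp Require Import complex reals.

Set Implicit Arguments.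
Unset Strict Implicit.
Unset Printing Implicit Defensive.

Import GRing.Theory Num.Theory.
Local Open Scope ring_scope.

(** The group [G] acts on itself by conjugation; let [rho] be the permutation
representation. Every matrix of [T(G)] commutes with [rho]. Conversely the
orbits of [G] on pairs [(x, y)] are determined by the classes of [x], [y] and
[y x^-1], because [G] has an abelian subgroup [<a>] of index 2; hence the
products [E_i^* A_j E_k^*] span the whole commutant of [rho], and [T(G)] is this
commutant.

The blocks of the commutant are the multiplicity algebras of [rho]. The weight
projectors [e_k = 1/n sum_j z^(jk) rho(a^j)] of [<a>] are permuted by [b]:
[b e_k b = e_(ks)]. The fixed weights (those with [n/tau %| k]) split further
under [1/2 (1 +- b)] and give the one-dimensional representations of [G], the
others pair up to the two-dimensional ones. The size of each block is the rank
of an idempotent, hence its trace, which is computed from the orders of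
centralizers: [#|C(a^j)|] is [2n] or [n], and [#|C(a^j b)| = 2 tau]. *)

(** * Splitting idempotents into full matrix blocks *)

Section Idempotents.
Variables (F : fieldType) (N : nat).
Implicit Types e : 'M[F]_N.

(** Take a rank factorization [e = Q *m P]: idempotence reads [Q P Q P = Q P], and cancelling the
    full-rank factors leaves [P Q = 1]. Then [A |-> P A Q] identifies the corner of [e] with
    matrices of size [r]. *)
Lemma idempotent_split e (r : nat) : e *m e = e -> \rank e = r ->
  {PQ : 'M[F]_(r, N) * 'M[F]_(N, r) |
    PQ.2 *m PQ.1 = e & PQ.1 *m PQ.2 = 1%:M}.
Proof.
move=> ee <-; exists (row_base e, col_base e) => /=; first exact: mulmx_base.
have := (mulmx_base e, row_base_free e, col_base_full e).
move: (row_base e) (col_base e) => P Q [[QP fP] fQ].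
have: Q *m (P *m Q *m P) = Q *m (1%:M *m P).
  by rewrite mul1mx !mulmxA QP -mulmxA QP.
by move/(row_full_inj fQ)/(row_free_inj fP).
Qed.

Lemma mxtrace_idempotent e : e *m e = e -> \tr e = (\rank e)%:R.
Proof.
move=> ee; have [[P Q] /= QPe PQ1] := idempotent_split ee erefl.
by rewrite -[in LHS]QPe mxtrace_mulC PQ1 mxtrace1.
Qed.

Lemma mx_subalgebra0 (S : 'M[F]_N -> Prop) : mx_subalgebra S -> S 0.
Proof.
by case=> S1 SD _; have := SD (-1) _ _ S1 S1; rewrite scaleN1r addNr.
Qed.

Lemma mx_subalgebraZ (S : 'M[F]_N -> Prop) c A :
  mx_subalgebra S -> S A -> S (c *: A).
Proof.
move=> subS SA; have [_ SD _] := subS.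
by rewrite -[_ *: _]addr0; apply: SD => //; apply: mx_subalgebra0.
Qed.

Lemma mx_subalgebra_sum (S : 'M[F]_N -> Prop) (I : Type) (r : seq I) (P : pred I)
    (X : I -> 'M[F]_N) :
  mx_subalgebra S -> (forall i, P i -> S (X i)) -> S (\sum_(i <- r | P i) X i).
Proof.
move=> subS SX; elim/big_ind: _ => // [|A B SA SB].
  exact: mx_subalgebra0.
by have [_ SD _] := subS; have := SD 1 _ _ SA SB; rewrite scale1r.
Qed.

(* The irreducible representations indexed by [J] have degree 2 and the others
   degree 1: [e i] projects onto one weight line of each copy of the i-th
   irreducible, and [b] exchanges the two weight lines when [J i]. *)
Lemma mx_isomorphic_idempotents (S : 'M[F]_N -> Prop) (I : finType)
    (d : I -> nat) (e : I -> 'M[F]_N) (b : 'M[F]_N) (J : pred I) :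
  mx_subalgebra S ->
  (forall A, S A -> A *m b = b *m A) ->
  (forall A i, S A -> A *m e i = e i *m A) ->
  (forall i X, ~~ J i -> S (e i *m X *m e i)) ->
  (forall i X, J i -> S (e i *m X *m e i + b *m (e i *m X *m e i) *m b)) ->
  (forall i j, e i *m e j = if i == j then e i else 0) ->
  (forall i j, J j -> e i *m b *m e j = 0) ->
  \sum_i (e i + if J i then b *m e i *m b else 0) = 1%:M ->
  (forall i, \rank (e i) = d i) ->
  mx_isomorphic S d.
Proof.
move=> subS Sb Se SnJ SJ ee ebe sum1 rk.
have ee1 i : e i *m e i = e i by rewrite ee eqxx.
pose PQ i := idempotent_split (ee1 i) (rk i).
pose P i := (sval (PQ i)).1; pose Q i := (sval (PQ i)).2.
have QP i : Q i *m P i = e i by rewrite /P /Q; case: (PQ i).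
have PQ1 i : P i *m Q i = 1%:M by rewrite /P /Q; case: (PQ i).
have Pe i : P i *m e i = P i by rewrite -QP mulmxA PQ1 mul1mx.
have eQ i : e i *m Q i = Q i by rewrite -QP -mulmxA PQ1 mulmx1.
pose f A i := P i *m A *m Q i.
have fe A i : Q i *m f A i *m P i = e i *m A *m e i.
  by rewrite /f !mulmxA QP -!mulmxA QP.
have [S1 SD SM] := subS.
exists f; split=> [c A B _ _ i|A B SA SB i|i|A B SA SB fAB|u].
- by rewrite /f mulmxDr mulmxDl -scalemxAr -scalemxAl.
- rewrite /f !mulmxA -(mulmxA _ (Q i)) QP -(mulmxA _ (e i)) -Se //.
  by rewrite !mulmxA -(mulmxA _ (e i)) eQ.
- by rewrite /f mulmx1 PQ1.
- rewrite -[A]mulmx1 -[B]mulmx1 -sum1 !mulmx_sumr; apply: eq_bigr => i _.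
  (* The corner at [e i] determines [A *m e i]; the part at [b *m e i *m b] follows, since [b]
     commutes with [A]. *)
  have AB : A *m e i = B *m e i.
    by rewrite -[e i]ee1 !mulmxA (Se _ _ SA) (Se _ _ SB) -!fe fAB.
  rewrite !mulmxDr AB; congr (_ + _); case: (J i); last by rewrite !mulmx0.
  by rewrite !mulmxA (Sb _ SA) (Sb _ SB) -!(mulmxA b) AB.
(* [X i] lifts [u i] to the corner of [e i]. When [J i], the copy conjugated by [b] is added to land
   in [S]; the vanishing of [e i *m b *m e j] makes [f] kill that copy. *)
pose X i := e i *m (Q i *m u i *m P i) *m e i.
have XE i : X i = Q i *m u i *m P i by rewrite /X !mulmxA eQ -!mulmxA Pe.
have PX i j : P i *m X j *m Q i = if i == j then u i else 0.
  rewrite /X; case: eqP => [<-|/eqP ij].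
    by rewrite -/(X i) XE !mulmxA PQ1 mul1mx -mulmxA PQ1 mulmx1.
  by rewrite -(Pe i) !mulmxA -(mulmxA (P i)) ee (negPf ij) mulmx0 !mul0mx.
exists (\sum_i (X i + if J i then b *m X i *m b else 0)).
  apply: mx_subalgebra_sum => // i _; case: ifP => Ji; first exact: SJ.
  by rewrite addr0; apply: SnJ; rewrite Ji.
move=> i; rewrite /f mulmx_sumr mulmx_suml (bigD1 i) //= big1 => [|j ji].
  rewrite addr0 mulmxDr mulmxDl PX eqxx; case: ifP => Ji.
    by rewrite /X -(Pe i) !mulmxA -(mulmxA (P i)) -(mulmxA (P i)) ebe //
      mulmx0 !mul0mx addr0.
  by rewrite mulmx0 mul0mx addr0.
rewrite mulmxDr mulmxDl PX eq_sym (negPf ji) add0r; case: ifP => Jj.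
  by rewrite /X -(Pe i) !mulmxA -(mulmxA (P i)) -(mulmxA (P i)) ebe //
      mulmx0 !mul0mx.
by rewrite mulmx0 mul0mx.
Qed.

End Idempotents.

(** * The conjugation representation and its commutant *)

Section ConjugationRepresentation.
Variables (F : fieldType) (gT : finGroupType) (G : {group gT}).
Implicit Types (x y : 'I_#|G|) (A : 'M[F]_#|G|).

Lemma gelt_in x : gelt x \in G. Proof. exact: enum_valP. Qed.

Lemma gelt_inj : injective (@gelt gT G). Proof. exact: enum_val_inj. Qed.

(** The identity of [G] only supplies a default index, which is not reached when [g] lies in [G]. *)
Definition conj_idx (g : gT) x : 'I_#|G| :=
  enum_rank_in (group1 G) (gelt x ^ g)%g.

Lemma gelt_conj g x : g \in G -> gelt (conj_idx g x) = (gelt x ^ g)%g.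
Proof. by move=> Gg; rewrite /gelt enum_rankK_in // groupJ // gelt_in. Qed.

Lemma conj_idxK g : g \in G -> cancel (conj_idx g) (conj_idx g^-1).
Proof.
by move=> Gg x; apply: gelt_inj; rewrite !gelt_conj ?groupV // conjgK.
Qed.

Lemma conj_idxVK g : g \in G -> cancel (conj_idx g^-1) (conj_idx g).
Proof.
by move=> Gg x; apply: gelt_inj; rewrite !gelt_conj ?groupV // conjgKV.
Qed.

Definition conj_mx (g : gT) : 'M[F]_#|G| :=
  \matrix_(x, y) (gelt y == gelt x ^ g)%g%:R.

Lemma conj_mx_mull g A x y : g \in G -> (conj_mx g *m A) x y = A (conj_idx g x) y.
Proof.
move=> Gg; rewrite mxE (bigD1 (conj_idx g x)) //= big1 => [|z zx].
  by rewrite mxE gelt_conj // eqxx mul1r addr0.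
by rewrite mxE -gelt_conj // (inj_eq gelt_inj) (negPf zx) mul0r.
Qed.

Lemma conj_mx_mulr g A x y :
  g \in G -> (A *m conj_mx g) x y = A x (conj_idx g^-1 y).
Proof.
move=> Gg; rewrite mxE (bigD1 (conj_idx g^-1 y)) //= big1 => [|z zy].
  by rewrite mxE -gelt_conj // conj_idxVK // eqxx mulr1 addr0.
rewrite mxE -gelt_conj // (inj_eq gelt_inj).
have -> : (y == conj_idx g z) = (z == conj_idx g^-1 y).
  by apply/eqP/eqP=> ->; rewrite ?conj_idxK ?conj_idxVK.
by rewrite (negPf zy) mulr0.
Qed.

Lemma conj_mx1 : conj_mx 1 = 1%:M.
Proof.
by apply/matrixP=> x y; rewrite !mxE conjg1 (inj_eq gelt_inj) eq_sym.
Qed.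

Lemma conj_mxM g h : g \in G -> conj_mx (g * h) = conj_mx g *m conj_mx h.
Proof.
by move=> Gg; apply/matrixP=> x y; rewrite conj_mx_mull // !mxE gelt_conj // conjgM.
Qed.

Lemma mxtrace_conj_mx g : g \in G -> \tr (conj_mx g) = #|'C_G[g]%g|%:R.
Proof.
move=> Gg; pose f (z : gT) : F := (z == z ^ g)%g%:R.
have -> : \tr (conj_mx g) = \sum_(x < #|G|) f (enum_val x).
  by apply: eq_bigr => x _; rewrite mxE.
rewrite -(big_enum_val (A := mem G) f) -sum1_card natr_sum.
rewrite big_mkcond [RHS]big_mkcond; apply: eq_bigr => z _; rewrite /f.
have -> : (z == z ^ g)%g = (z \in 'C[g]%g).
  by rewrite eq_sym conjg_fix; apply/commgP/cent1P.
rewrite in_setI; change (z \in mem G) with (z \in G).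
by case: (z \in G); case: (z \in 'C[g]%g).
Qed.

Lemma conj_mx_commP g A : g \in G ->
  A *m conj_mx g = conj_mx g *m A <->
  forall x y, A (conj_idx g x) (conj_idx g y) = A x y.
Proof.
move=> Gg; split=> [/matrixP cA x y|cA].
  by have := cA x (conj_idx g y); rewrite conj_mx_mulr // conj_mx_mull // conj_idxK.
apply/matrixP=> x y; rewrite conj_mx_mulr // conj_mx_mull //.
by rewrite -cA conj_idxVK.
Qed.

Lemma mem_classes_conj C z g :
  C \in classes G -> g \in G -> (z ^ g \in C)%g = (z \in C).
Proof. by case/imsetP=> w Gw -> Gg; rewrite memJ_norm ?(subsetP (class_norm _ _)). Qed.

Lemma terwilliger_comm A g :
  terwilliger (G := G) A -> g \in G -> A *m conj_mx g = conj_mx g *m A.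
Proof.
(* The commutant of [conj_mx g] is a subalgebra, so only the generators need to be tested. *)
move=> TA Gg; apply: (TA (fun A => A *m conj_mx g = conj_mx g *m A)).
  split=> [|c B D cB cD|B D cB cD]; first by rewrite mulmx1 mul1mx.
    by rewrite mulmxDl mulmxDr -scalemxAl -scalemxAr cB cD.
  by rewrite -mulmxA cD !mulmxA cB.
move=> B [C CC [->|->]]; apply/conj_mx_commP=> // x y; rewrite !mxE.
  by rewrite !gelt_conj // -conjVg -conjMg mem_classes_conj.
by rewrite (inj_eq (can_inj (conj_idxK Gg))) gelt_conj // mem_classes_conj.
Qed.

Lemma terwilliger_subalgebra : mx_subalgebra (terwilliger (F := F) (G := G)).
Proof.
split=> [S [S1 _ _] _ //|c A B TA TB S subS genS|A B TA TB S subS genS].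
  by have [_ SD _] := subS; apply: SD; [apply: TA | apply: TB].
by have [_ _ SM] := subS; apply: SM; [apply: TA | apply: TB].
Qed.

Lemma class_tripleE C1 C2 C3 x y :
  (class_dual_idem F G C1 *m class_adj F G C2 *m class_dual_idem F G C3) x y
  = [&& gelt x \in C1, (gelt y * (gelt x)^-1)%g \in C2 & gelt y \in C3]%:R.
Proof.
rewrite mxE (bigD1 y) //= big1 => [|z zy]; last first.
  by rewrite [class_dual_idem _ _ _ _ _]mxE (negPf zy) mulr0.
rewrite mxE (bigD1 x) //= big1 => [|z zx]; last first.
  by rewrite [class_dual_idem _ _ _ _ _]mxE eq_sym (negPf zx) mul0r.
by rewrite !mxE !eqxx !addr0 /= -!natrM !mulnb andbA.
Qed.

End ConjugationRepresentation.

(** * Conjugacy of pairs when an abelian subgroup has index 2 *)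

Section AbelianIndexTwo.
Variables (gT : finGroupType) (H G : {group gT}).
Hypotheses (sHG : H \subset G) (abH : abelian H) (index2 : #|G : H|%g = 2).
Local Open Scope group_scope.

(** Otherwise [H], [H y] and [H x y] would be three distinct cosets. *)
Lemma index2_mul x y : x \in G -> y \in G -> x \notin H -> y \notin H -> x * y \in H.
Proof.
move=> Gx Gy nHx nHy; apply: contraR nHx => nHxy.
have nx1 : H :* 1 != H :* y.
  by apply: contra nHy => /eqP e; rewrite -(mulg1 H) e rcoset_refl.
have nx2 : H :* 1 != H :* (x * y).
  by apply: contra nHxy => /eqP e; rewrite -(mulg1 H) e rcoset_refl.
have [|e] := eqVneq (H :* y) (H :* (x * y)).
  by move/rcoset_eqP; rewrite mem_rcoset invMg mulgA mulgV mul1g groupV.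
have sub : (H :* 1) |: [set H :* y; H :* (x * y)] \subset rcosets H G.
  by rewrite !subUset !sub1set !mem_rcosets mulSGid // group1 Gy groupM.
have := subset_leq_card sub; rewrite -/(indexg _ _) index2.
by rewrite cardsU1 !inE cards2 (negPf nx1) (negPf nx2) e.
Qed.

(** [H] centralizes [u], so [u ^ g] depends only on the coset of [g]. *)
Lemma conjg_abelian_index2 u g h :
  u \in H -> g \in G -> h \in G -> h \notin H -> u ^ g = u \/ u ^ g = u ^ h.
Proof.
move=> Hu Gg Gh nHh; have [Hg|nHg] := boolP (g \in H).
  by left; apply/conjg_fixP/commgP; apply: (centsP abH).
right; have Hgh : g * h^-1 \in H by rewrite index2_mul ?groupV.
rewrite -[g](mulgKV h) conjgM; congr (_ ^ _).
by apply/conjg_fixP/commgP; apply: (centsP abH).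
Qed.

(** The conjugator is [1], [h], [y * h] or [x], depending on which elements lie in [H]: elements of
    [H] commute, [x] and [y] fix themselves, and an element of [H] has at most two conjugates. *)
Lemma conj_pair_fixed x y y' : x \in G -> y \in G ->
  y' \in y ^: G -> y' * x^-1 \in (y * x^-1) ^: G ->
  exists2 g, g \in G & x ^ g = x /\ y ^ g = y'.
Proof.
move=> Gx Gy /imsetP[h Gh ->] /imsetP[k Gk E].
have fixJ (z : gT) : z ^ z = z by rewrite /conjg mulKg.
have [Hx|nHx] := boolP (x \in H); have [Hy|nHy] := boolP (y \in H).
- have [Hh|nHh] := boolP (h \in H).
    by exists h => //; split=> //; apply/conjg_fixP/commgP; apply: (centsP abH).
  have Hz : y * x^-1 \in H by rewrite groupM ?groupV.
  (* Either the quotient is unmoved and [y ^ h = y], or it moves as under [h], which forces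
     [x ^ h = x]. *)
  have [|e] := conjg_abelian_index2 Hz Gk Gh nHh.
    by rewrite -E => /mulIg->; exists 1; rewrite ?conjg1.
  by exists h => //; split=> //; move: E; rewrite e conjMg conjVg => /mulgI/invg_inj.
- have [Hh|nHh] := boolP (h \in H).
    by exists h => //; split=> //; apply/conjg_fixP/commgP; apply: (centsP abH).
  exists (y * h); first by rewrite groupM.
  split; last by rewrite conjgM fixJ.
  apply/conjg_fixP/commgP; apply: (centsP abH) => //; exact: index2_mul.
- have [->|->] := conjg_abelian_index2 Hy Gh Gx nHx.
    by exists 1; rewrite ?conjg1.
  by exists x.
have Hz : y * x^-1 \in H by rewrite index2_mul ?groupV.
have [e|e] := conjg_abelian_index2 Hz Gk Gx nHx.
  by move: E; rewrite e => /mulIg->; exists 1; rewrite ?conjg1.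
exists x => //; split=> //; move: E; rewrite e conjMg conjVg fixJ.
by move/mulIg.
Qed.

(** Conjugating back by [h^-1] reduces to an unchanged first coordinate. *)
Lemma conj_pair x y x' y' : x \in G -> y \in G ->
  x' \in x ^: G -> y' \in y ^: G -> y' * x'^-1 \in (y * x^-1) ^: G ->
  exists2 g, g \in G & x ^ g = x' /\ y ^ g = y'.
Proof.
move=> Gx Gy /imsetP[h Gh ->] yy' E.
have [//|//|||g Gg [gx gy]] := @conj_pair_fixed x y (y' ^ h^-1).
- by rewrite memJ_norm ?(subsetP (class_norm _ _)) ?groupV.
- rewrite -{1}[x](conjgK h) -conjVg -conjMg.
  by rewrite memJ_norm ?(subsetP (class_norm _ _)) ?groupV.
by exists (g * h); rewrite ?groupM // !conjgM gx gy conjgKV.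
Qed.

(** By [conj_pair], the pairs with three prescribed classes form at most one orbit, on which an
    invariant matrix is constant; so [A] is a combination of the indicator matrices of
    [class_tripleE]. *)
Lemma comm_terwilliger (F : fieldType) (A : 'M[F]_#|G|) :
  (forall g, g \in G -> A *m conj_mx F G g = conj_mx F G g *m A)%R ->
  terwilliger (G := G) A.
Proof.
move=> cA S subS genS.
have invA g x y : g \in G -> A (conj_idx g x) (conj_idx g y) = A x y.
  by move=> Gg; have [inv _] := conj_mx_commP A Gg; apply/inv/cA.
pose inT (t : {set gT} * {set gT} * {set gT}) (p : 'I_#|G| * 'I_#|G|) :=
  [&& gelt p.1 \in t.1.1, (gelt p.2 * (gelt p.1)^-1)%g \in t.1.2
    & gelt p.2 \in t.2].
(* The common value of [A] on the pairs of type [t]; the default [0] serves types met by no pair. *)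
pose c t := (if [pick p | inT t p] is Some p then A p.1 p.2 else 0)%R.
pose cl t := [&& t.1.1 \in classes G, t.1.2 \in classes G & t.2 \in classes G].
suff -> : A = (\sum_(t | cl t) c t *: (class_dual_idem F G t.1.1
    *m class_adj F G t.1.2 *m class_dual_idem F G t.2))%R.
  have [_ _ SM] := subS; apply: mx_subalgebra_sum => // t /and3P[C1 C2 C3].
  apply: mx_subalgebraZ => //; apply: (SM _ _ (SM _ _ _ _)); apply: genS.
  - by exists t.1.1; rewrite //; right.
  - by exists t.1.2; rewrite //; left.
  - by exists t.2; rewrite //; right.
apply/matrixP=> x y.
set t0 := (gelt x ^: G, (gelt y * (gelt x)^-1) ^: G, gelt y ^: G).
have cl0 : cl t0.
  by rewrite /cl /= !mem_classes ?groupM ?groupV ?gelt_in.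
rewrite summxE (bigD1 t0) //= big1 ?GRing.addr0 => [|t /andP[/and3P[C1 C2 C3] ne]].
  rewrite mxE class_tripleE /= !class_refl GRing.mulr1 /c.
  case: pickP => [[x' y'] /and3P[/= X Y Z]|/(_ (x, y))]; last first.
    by rewrite /inT /= !class_refl.
  have [g Gg [gx gy]] := conj_pair (gelt_in x) (gelt_in y) X Z Y.
  rewrite -(invA g) //; congr (A _ _); apply: gelt_inj; rewrite gelt_conj //.
rewrite mxE class_tripleE; case: and3P => [[X Y Z]|]; last by rewrite GRing.mulr0.
case/negP: ne; apply/eqP; case: t C1 C2 C3 X Y Z => [[D1 D2] D3] /=.
have eqC z D : D \in classes G -> z \in D -> D = z ^: G.
  by case/imsetP=> w Gw -> /class_eqP->.
by move=> ? ? ? X Y Z; rewrite /t0 -(eqC _ D1) // -(eqC _ D2) // -(eqC _ D3).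
Qed.

End AbelianIndexTwo.

(** * From the presentation to a concrete group of order [2 * n] *)

Lemma Zp_nat_eq n i j : (1 < n)%N -> (i%:R == j%:R :> 'Z_n) = (i == j %[mod n])%N.
Proof. by move=> n1; rewrite -(inj_eq val_inj) /= !val_Zp_nat. Qed.

Section Presentation.
Variables n s : nat.
Hypotheses (n_gt1 : (1 < n)%N).
Hypotheses (s_sqr : (s ^ 2 = 1 %[mod n])%N) (s_neq1 : (s <> 1 %[mod n])%N).

Let s2 : s%:R * s%:R = 1 :> 'Z_n.
Proof.
by rewrite -natrM -[RHS]/(1%:R); apply/eqP; rewrite Zp_nat_eq // mulnn; apply/eqP.
Qed.

Let aff_mul : 'Z_n -> 'Z_n := fun x => x * s%:R.
Let aff_mul_inj : injective aff_mul.
Proof. by apply: (can_inj (g := aff_mul)) => x; rewrite /aff_mul -mulrA s2 mulr1. Qed.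

Let t : {perm 'Z_n} := perm (@addIr _ (1 : 'Z_n)).
Let m : {perm 'Z_n} := perm aff_mul_inj.

Let tX k x : (t ^+ k)%g x = x + k%:R.
Proof.
elim: k => [|k IHk]; first by rewrite perm1 addr0.
by rewrite expgSr permM IHk permE -addrA natr1.
Qed.

(* Realising the presentation by affine permutations of Z/n shows that the
   relations do not collapse. *)
Lemma presentation_card_lower (gT : finGroupType) (G : {group gT}) :
  (G \isog Grp (a : b : a ^+ n, b ^+ 2, b * a * b^-1 = a ^+ s))%g ->
  (2 * n <= #|G|)%N.
Proof.
pose H := (<[t]> <*> <[m]>)%G => isoG.
have tn : (t ^+ n)%g = 1%g.
  apply/permP=> x; rewrite tX perm1 -[RHS]addr0; congr (_ + _).
  by apply/eqP; rewrite (Zp_nat_eq _ 0) // modnn mod0n.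
have m2 : (m ^+ 2)%g = 1%g.
  by apply/permP=> x; rewrite expgS expg1 permM !permE /aff_mul -mulrA s2 mulr1.
have mtm : (m * t * m^-1)%g = (t ^+ s)%g.
  apply: (mulIg m); rewrite mulgKV; apply/permP=> x.
  by rewrite !permM tX !permE /aff_mul mulrDl s2.
have: (H \homg G)%g.
  rewrite isoG; apply/existsP; exists (t, m).
  by rewrite /= !xpair_eqE tn m2 mtm !eqxx.
case/homgP=> f fG; apply: leq_trans (leq_morphim f G); rewrite fG.
have ot : #[t]%g = n.
  apply/eqP; rewrite eqn_dvd order_dvdn tn eqxx /=.
  have /permP/(_ 0) := expg_order t; rewrite tX perm1 add0r => /eqP.
  by rewrite (Zp_nat_eq _ 0) // mod0n.
have sH : <[t]>%g \subset H by apply: joing_subl.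
rewrite -(Lagrange sH) -orderE ot mulnC leq_pmul2l ?(ltnW n_gt1) //.
rewrite indexg_gt1; apply/negP=> sHt.
have /cycleP[k mk] : m \in <[t]>%g.
  by apply: (subsetP sHt); apply: (subsetP (joing_subr _ _)); apply: cycle_id.
(* [m] fixes [0], so a translation equal to [m] is trivial; evaluating at [1] then gives [s = 1]
   modulo [n]. *)
have k0 : k%:R = 0 :> 'Z_n.
  have /permP/(_ 0) := mk; rewrite tX permE /aff_mul mul0r add0r => <- //.
case: s_neq1; apply/eqP; rewrite -Zp_nat_eq //.
by have /permP/(_ 1) := mk; rewrite tX permE /aff_mul mul1r k0 addr0 => ->.
Qed.

(** [<[b]>] normalizes [<[a]>], so the order of [G] is at most that of [a] times that of [b], hence
    at most [2 * n]; the lower bound forces equality. *)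
Lemma presentation_structure (gT : finGroupType) (G : {group gT}) :
  (G \isog Grp (a : b : a ^+ n, b ^+ 2, b * a * b^-1 = a ^+ s))%g ->
  exists a b : gT, [/\ a \in G /\ b \in G, #[a]%g = n, b \notin <[a]>%g,
    (b * b = 1)%g /\ (b * a * b = a ^+ s)%g & #|G| = (2 * n)%N].
Proof.
move=> isoG; have le2n := presentation_card_lower isoG.
have /existsP[[a b] /eqP[/= defG an b2 ba]] := isoGrp_hom isoG.
have b1 : (b * b = 1)%g by rewrite -b2 expgS expg1.
have bV : (b^-1 = b)%g by apply/eqP; rewrite eq_invg_mul b1.
have Nb : <[b]>%g \subset 'N(<[a]>)%g.
  rewrite cycle_subG inE -genJ gen_subG conjg_set1 sub1set.
  by rewrite conjgE bV mulgA -{2}bV ba mem_cycle.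
have oG : (#|G| <= #[a]%g * #[b]%g)%N.
  rewrite -defG norm_joinEr // -(leq_pmul2r (cardG_gt0 (<[a]> :&: <[b]>)%G)).
  by rewrite mul_cardG leq_pmulr ?cardG_gt0.
have oa : (#[a]%g <= n)%N by rewrite dvdn_leq ?(ltnW n_gt1) // order_dvdn an.
have ob : (#[b]%g <= 2)%N by rewrite dvdn_leq // order_dvdn b2.
have oG' : (#|G| <= 2 * #[a]%g)%N.
  by rewrite (leq_trans oG) // mulnC leq_pmul2r ?order_gt0.
have oan : #[a]%g = n.
  by apply/eqP; rewrite eqn_leq oa -(leq_pmul2l (isT : 0 < 2)%N) (leq_trans le2n).
exists a, b; split=> //.
- rewrite -defG; split; [apply: (subsetP (joing_subl _ _)) |
    apply: (subsetP (joing_subr _ _))]; exact: cycle_id.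
- apply/negP=> ab; have /joing_idPl e : <[b]>%g \subset <[a]>%g by rewrite cycle_subG.
  move: le2n; rewrite -defG e -orderE oan leqNgt mulnC muln2 -addnn.
  by rewrite -[X in (X < _)%N]add0n ltn_add2r (ltnW n_gt1).
- by split=> //; rewrite -{2}bV.
- by apply/eqP; rewrite eqn_leq le2n andbT (leq_trans oG') // oan.
Qed.

End Presentation.

(** * Multiplication by [s] modulo [n] *)

Section Arithmetic.
Local Open Scope nat_scope.
Variables n s : nat.
Hypotheses (n_gt0 : 0 < n) (s_gt0 : 0 < s) (s_sqr : s ^ 2 = 1 %[mod n]).
Local Notation tau := (tau n s).
Local Notation m := (n %/ tau).

Lemma tau_gt0 : 0 < tau. Proof. by rewrite gcdn_gt0 n_gt0 orbT. Qed.

Lemma tau_mul : tau * m = n. Proof. by rewrite mulnC divnK // dvdn_gcdr. Qed.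

Lemma dvdn_cotau : m %| n.
Proof. by apply/dvdnP; exists tau; rewrite tau_mul. Qed.

Lemma cotau_gt0 : 0 < m.
Proof. by rewrite -(ltn_pmul2l tau_gt0) muln0 tau_mul. Qed.

(** The congruence says that [n] divides [k * (s - 1)]; dividing by [tau] leaves the cofactor
    [(s - 1) %/ tau], coprime to [m]. *)
Lemma eqn_mod_mul_s k : (k * s == k %[mod n]) = (m %| k).
Proof.
rewrite eqn_mod_dvd ?leq_pmulr // -[X in _ - X]muln1 -mulnBr.
rewrite -{1}tau_mul -{1}(divnK (dvdn_gcdl (s - 1) n : tau %| s - 1)).
rewrite mulnA [in X in _ %| X]mulnC dvdn_pmul2l ?tau_gt0 // Gauss_dvdl //.
rewrite coprime_sym /coprime -(eqn_pmul2r tau_gt0) muln_gcdl mul1n.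
by rewrite !divnK ?(dvdn_gcdl (s - 1) n) ?(dvdn_gcdr (s - 1) n) // gcdnC.
Qed.

Lemma mul_s_s k : k * s * s = k %[mod n].
Proof. by rewrite -mulnA mulnn -modnMmr s_sqr modnMmr muln1. Qed.

Lemma dvdn_cotau_mul_s k : (m %| k * s) = (m %| k).
Proof.
apply/idP/idP => [h|]; last exact: dvdn_mulr.
have: m %| k * s * s by rewrite dvdn_mulr.
by rewrite /dvdn -(modn_dvdm _ dvdn_cotau) mul_s_s modn_dvdm // dvdn_cotau.
Qed.

Lemma ksim_equivalence : {in krange n s & &, equivalence_rel (@ksim n s)}.
Proof.
move=> k l r _ _ _; split=> [|/orP[/eqP->//|/eqP lk]]; first by rewrite /ksim eqxx.
rewrite /ksim orbC; congr (_ || _).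
  by rewrite -lk -(inj_eq val_inj) /= !modn_small.
by rewrite -modnMml lk modnMml mul_s_s -(inj_eq val_inj) /= !modn_small.
Qed.

Definition mul_s (k : 'I_n) : 'I_n := Ordinal (ltn_pmod (k * s) n_gt0).

Lemma pblock_kclasses k : k \in krange n s ->
  pblock (kclasses n s) k = [set k; mul_s k].
Proof.
move=> Dk; have part := equivalence_partitionP ksim_equivalence.
apply/setP=> l; rewrite in_set2.
have [Dl|nDl] := boolP (l \in krange n s).
  rewrite pblock_equivalence_partition //; last exact: ksim_equivalence.
  by rewrite /ksim -[l == mul_s k](inj_eq val_inj) /= [l %% n]modn_small.
have -> : (l \in pblock (kclasses n s) k) = false.
  apply: contraNF nDl => lk; rewrite -(cover_partition part).
  apply/bigcupP; exists (pblock (kclasses n s) k) => //; apply: pblock_mem.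
  by rewrite (cover_partition part).
apply/esym/norP; split; apply: contraNneq nDl => -> //.
move: Dk; rewrite !inE /= => /andP[_ nm].
have nm' : ~~ (m %| (k * s) %% n).
  by rewrite /dvdn modn_dvdm ?dvdn_cotau // -/(dvdn _ _) dvdn_cotau_mul_s.
by rewrite nm' andbT lt0n; apply: contraNneq nm' => ->; rewrite dvdn0.
Qed.

Section Transversal.
Variable K : {set 'I_n}.
Hypothesis K_repr : is_transversal K (kclasses n s) (krange n s).

Lemma transversal_cotau k : k \in K -> ~~ (m %| k).
Proof.
case/and3P: K_repr => _ /subsetP sKD _ /sKD.
by rewrite inE => /andP[].
Qed.

(** If [k] were [l * s], both would lie in one class, so [k = l]; but a fixed point of
    multiplication by [s] is a multiple of [m]. *)
Lemma transversal_mul_s k l : k \in K -> l \in K -> k != l * s %[mod n].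
Proof.
move=> Kk Kl; apply/negP=> /eqP kls.
have sKD := subsetP (transversal_sub K_repr).
have kl : k = mul_s l by apply: val_inj; rewrite /= -kls modn_small.
have e : k = l.
  apply: (pblock_inj K_repr) => //; rewrite !pblock_kclasses ?sKD //.
  have -> : mul_s k = l.
    by apply: val_inj; rewrite /= kl /= modnMml mul_s_s modn_small.
  by rewrite setUC kl.
by have := transversal_cotau Kl; rewrite -eqn_mod_mul_s -kls e eqxx.
Qed.

(** Each class has exactly two elements, as [krange] contains no fixed point of multiplication by
    [s]. *)
Lemma transversal_big (V : nmodType) (f : 'I_n -> V) :
  (\sum_(k in krange n s) f k = \sum_(k in K) (f k + f (mul_s k)))%R.
Proof.
have sKD := subsetP (transversal_sub K_repr).
rewrite (set_partition_big _ (equivalence_partitionP ksim_equivalence)).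
rewrite -/(kclasses n s) -(pblock_transversal K_repr) big_imset /=; last first.
  exact: pblock_inj K_repr.
apply: eq_bigr => k Kk; rewrite pblock_kclasses ?sKD // big_setU1 ?big_set1 //.
rewrite inE; apply: contra (transversal_mul_s Kk Kk) => /eqP {1}->.
by rewrite /= modn_mod.
Qed.

End Transversal.

End Arithmetic.

(** * Sums over multiples and over roots of unity *)

Lemma sum_dvdn_ord (V : nmodType) t m n (f : nat -> V) :
  (0 < m)%N -> (t * m)%N = n ->
  \sum_(j < n | (m %| j)%N) f j = \sum_(i < t) f (i * m)%N.
Proof.
move=> m0 <-; rewrite -(big_mkord (fun j => m %| j)%N f) -[RHS](big_mkord xpredT (fun i => f (i * m)%N)).
elim: t => [|t IHt]; first by rewrite mul0n !big_geq.
rewrite [RHS]big_nat_recr //= -IHt (big_cat_nat _ (n := (t * m)%N)) ?leq_mul //=.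
congr (_ + _); rewrite big_ltn_cond ?ltn_pmul2r // dvdn_mull //.
rewrite big1_seq ?addr0 // => j /andP[/dvdnP[i ->]].
by rewrite mem_index_iota ltn_pmul2r // => /andP[lo]; rewrite ltn_pmul2r // ltnS leqNgt lo.
Qed.

Lemma sum_root_unity (F : fieldType) (x : F) t :
  x ^+ t = 1 -> \sum_(j < t) x ^+ j = if x == 1 then t%:R else 0.
Proof.
move=> xt; case: eqP => [->|/eqP nx].
  by under eq_bigr do rewrite expr1n; rewrite sumr_const card_ord.
have /eqP := subrX1 x t; rewrite xt subrr eq_sym mulf_eq0 subr_eq0 (negPf nx).
by move/eqP.
Qed.

(** As [n] is invertible in [F], ['X^n - 1] is separable; its [n] distinct roots include a primitive
    one. *)
Lemma closed_field_prim_root (F : closedFieldType) n :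
  n%:R != 0 :> F -> {z : F | n.-primitive_root z}.
Proof.
move=> n0; have n_gt0 : (0 < n)%N by rewrite lt0n; apply: contraNneq n0 => ->.
pose p : {poly F} := 'X^n - 1; have [r Dp] := closed_field_poly_normal p.
apply/sigW; rewrite (monicP _) ?monicXnsubC // scale1r in Dp.
have rn1: all n.-unity_root r by apply/allP=> z; rewrite -root_prod_XsubC -Dp.
have sz_r: (n < (size r).+1)%N.
  by rewrite -(size_prod_XsubC r id) -Dp size_XnsubC.
have [|z] := hasP (has_prim_root n_gt0 rn1 _ sz_r); last by exists z.
by rewrite -separable_prod_XsubC -Dp separable_Xn_sub_1.
Qed.

Section Metacyclic.
Variables (n s : nat) (gT : finGroupType) (G : {group gT}) (a b : gT).
Hypotheses (n_gt0 : (0 < n)%N) (s_gt0 : (0 < s)%N).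
Hypotheses (s_sqr : (s ^ 2 = 1 %[mod n])%N).
Hypotheses (Ga : a \in G) (Gb : b \in G) (oa : #[a]%g = n).
Hypotheses (nab : b \notin <[a]>%g) (bb : (b * b = 1)%g).
Hypotheses (bab : (b * a * b = a ^+ s)%g) (oG : #|G| = (2 * n)%N).
Local Notation tau := (tau n s).
Local Notation m := (n %/ tau)%N.
Local Notation H := <[a]>%G.

(** * Orders of centralizers *)

Section Centralizers.
Local Open Scope group_scope.

Lemma sub_cycle : H \subset G. Proof. by rewrite cycle_subG. Qed.

Lemma index_cycle : #|G : H| = 2.
Proof. by rewrite -divgS ?sub_cycle // oG -orderE oa mulnK. Qed.

Lemma conj_b k : (a ^+ k) ^ b = a ^+ (k * s).
Proof.
have bV : b^-1 = b by apply/eqP; rewrite eq_invg_mul bb.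
by rewrite conjXg conjgE bV mulgA bab -expgM mulnC.
Qed.

Lemma index2_cycle x : x \in G -> x \notin H -> x * b \in H.
Proof. by move=> Gx Hx; apply: (index2_mul sub_cycle index_cycle). Qed.

Lemma cycle_commute x y : x \in H -> y \in H -> commute x y.
Proof. by move=> Hx Hy; apply: (centsP (cycle_abelian a)). Qed.

Lemma commute_b k : (a ^+ k \in 'C[b]) = (m %| k)%N.
Proof.
rewrite -(eqn_mod_mul_s n_gt0 s_gt0) -oa -eq_expg_mod_order -conj_b conjg_fix.
by apply/cent1P/commgP.
Qed.

(** The centralizer contains [H], so it is [H] or [G], depending on whether [b] commutes with
    [a ^+ k]. The additive form splits the trace of [weight_proj] into two character sums. *)
Lemma cent1_cycle k :
  #|'C_G[a ^+ k]| = (n + (if m %| k then n else 0))%N.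
Proof.
have sHC : H \subset 'C_G[a ^+ k].
  rewrite subsetI sub_cycle; apply/subsetP=> x Hx; apply/cent1P.
  by apply: cycle_commute => //; apply: mem_cycle.
case: ifPn => km.
  suff -> : 'C_G[a ^+ k] = G :> {set gT} by rewrite oG mul2n addnn.
  apply/eqP; rewrite eqEsubset subsetIl /=; apply/subsetP=> x Gx.
  have [/(subsetP sHC)//|/(index2_cycle Gx) /(subsetP sHC) Hxb] := boolP (x \in H).
  by rewrite -[x]mulg1 -bb mulgA groupM // inE Gb /= cent1C commute_b.
suff -> : 'C_G[a ^+ k] = H :> {set gT} by rewrite -orderE oa addn0.
apply/eqP; rewrite eqEsubset sHC andbT; apply/subsetP=> x; rewrite inE => /andP[Gx Cx].
apply: contraR km => nHx; have := subsetP sHC _ (index2_cycle Gx nHx).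
by case/setIP=> _; rewrite groupMl // cent1C commute_b.
Qed.

(** The centralizer contains [a ^+ k * b], outside [H], so its product with [H] is [G]; it meets [H]
    in [<[a ^+ m]>], of order [tau]. The product formula gives the order. *)
Lemma cent1_cycle_b k : #|'C_G[a ^+ k * b]| = (2 * tau)%N.
Proof.
set y := _ * b.
have Gy : y \in G by rewrite groupM ?groupX.
have nHy : y \notin H by rewrite groupMl ?mem_cycle.
have CHy : 'C_G[y] :&: H = <[a ^+ m]>.
  apply/setP=> x; rewrite in_setI in_setI; apply/idP/idP.
    case/andP=> /andP[_ Cx] /cycleP[i xi]; move: Cx; rewrite xi cent1C.
    rewrite groupMl; last by rewrite cent1E -!expgD addnC.
    rewrite cent1C commute_b => /dvdnP[j ->].
    by rewrite mulnC expgM mem_cycle.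
  case/cycleP=> i ->; rewrite -expgM groupX // mem_cycle andbT /= cent1C.
  rewrite groupM //; first by rewrite cent1E -!expgD addnC.
  by rewrite cent1C commute_b dvdn_mulr.
have CH : 'C_G[y] * H = G.
  apply/eqP; rewrite eqEsubset mul_subG ?subsetIl ?sub_cycle //=.
  apply/subsetP=> x Gx; have [Hx|nHx] := boolP (x \in H).
    by rewrite -[x]mul1g mem_mulg ?group1.
  rewrite -[x](mulKVg y) mem_mulg //; first by rewrite inE Gy cent1id.
  by rewrite (index2_mul sub_cycle index_cycle) ?groupV.
have nm : (n %/ m)%N = tau.
  by rewrite -[X in (X %/ _)%N](tau_mul n s) mulnK ?cotau_gt0.
have := mul_cardG 'C_G[y] H; rewrite CH CHy -!orderE oa oG orderXdiv oa ?dvdn_cotau //.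
by rewrite nm mulnAC => /eqP; rewrite eqn_pmul2r // => /eqP.
Qed.

End Centralizers.

(** * Weight and sign projectors, and their traces *)

Variable F : numFieldType.
Variable z : F.
Hypothesis z_prim : n.-primitive_root z.

Local Notation rho := (conj_mx F G).
Local Notation B := (rho b).

Lemma terwilliger_comm_generators (A : 'M[F]_#|G|) :
  A *m rho a = rho a *m A -> A *m B = B *m A ->
  terwilliger (G := G) A.
Proof.
move=> Aa Ab; apply: (comm_terwilliger sub_cycle (cycle_abelian a) index_cycle).
have AH x : x \in H -> A *m rho x = rho x *m A.
  case/cycleP=> i ->; elim: i => [|i IHi]; first by rewrite conj_mx1 mulmx1 mul1mx.
  by rewrite expgS conj_mxM // [LHS]mulmxA Aa -[LHS]mulmxA IHi mulmxA.
move=> g Gg; have [/AH//|/(index2_cycle Gg) Hgb] := boolP (g \in H).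
rewrite -[g]mulg1 -bb mulgA conj_mxM ?groupM // [LHS]mulmxA AH //.
by rewrite -[LHS]mulmxA Ab mulmxA.
Qed.

Lemma conj_mx_bb : B *m B = 1%:M.
Proof. by rewrite -conj_mxM // bb conj_mx1. Qed.

(* [rho a] acts on the image of [weight_proj k] by [z ^- k], not [z ^+ k]. *)
Definition weight_proj (k : nat) : 'M[F]_#|G| :=
  n%:R^-1 *: \sum_(j < n) z ^+ (j * k) *: rho (a ^+ j)%g.
Local Notation e := weight_proj.

Let n_neq0 : n%:R != 0 :> F.
Proof. by rewrite pnatr_eq0 -lt0n. Qed.

Let z_neq0 k : z ^+ k != 0.
Proof. by rewrite expf_eq0 (prim_root_eq0 z_prim) eqn0Ngt n_gt0 andbF. Qed.

Lemma weight_proj_comm k : e k *m rho a = rho a *m e k.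
Proof.
rewrite -scalemxAl -scalemxAr mulmx_suml mulmx_sumr; congr (_ *: _).
apply: eq_bigr => j _; rewrite -scalemxAl -scalemxAr -!conj_mxM ?groupX //.
by rewrite -expgS -expgSr.
Qed.

Lemma weight_proj_mul k : rho a *m e k = (z ^+ k)^-1 *: e k.
Proof.
apply: (scalerI (z_neq0 k)); rewrite scalerA mulfV // scale1r.
rewrite -scalemxAr scalerA mulrC -scalerA; congr (_ *: _).
rewrite mulmx_sumr scaler_sumr.
pose f j : 'M[F]_#|G| := z ^+ (j * k) *: rho (a ^+ j)%g.
transitivity (\sum_(j < n) f j.+1).
  apply: eq_bigr => j _.
  by rewrite -scalemxAr -conj_mxM // -expgS scalerA -exprD /f mulSn.
(* [rho a] shifts the index by one, and the last term wraps around to the first because [z] and [a]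
   have order [n]. *)
have fn : f n = f 0%N.
  by rewrite /f exprM (prim_expr_order z_prim) expr1n mul0n -oa expg_order.
have: \sum_(j < n.+1) f j = f 0%N + \sum_(j < n) f j.+1 by rewrite big_ord_recl.
by rewrite big_ord_recr /= fn addrC => /addrI<-.
Qed.

Lemma weight_proj_mulX k j : rho (a ^+ j)%g *m e k = (z ^+ k)^-1 ^+ j *: e k.
Proof.
elim: j => [|j IHj]; first by rewrite conj_mx1 mul1mx expr0 scale1r.
rewrite expgS conj_mxM // -mulmxA IHj -scalemxAr weight_proj_mul scalerA.
by rewrite exprSr.
Qed.

Lemma weight_proj_mod k l : k = l %[mod n] -> e k = e l.
Proof.
move=> kl; congr (_ *: _); apply: eq_bigr => j _; congr (_ *: _).
by apply/eqP; rewrite (eq_prim_root_expr z_prim) -modnMmr kl modnMmr.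
Qed.

(** The product is [e l] scaled by the mean of the first [n] powers of [z ^+ k / z ^+ l]. *)
Lemma weight_projM k l : e k *m e l = if k == l %[mod n] then e k else 0.
Proof.
rewrite {1}/weight_proj -scalemxAl mulmx_suml.
under eq_bigr => j _.
  rewrite -scalemxAl weight_proj_mulX scalerA mulnC exprM -exprMn; over.
rewrite -scaler_suml sum_root_unity; last first.
  by rewrite exprMn exprVn -!exprM ![(_ * n)%N]mulnC !exprM (prim_expr_order z_prim) !expr1n invr1 mulr1.
rewrite -(inj_eq (mulIf (z_neq0 l))) divfK // mul1r (eq_prim_root_expr z_prim).
case: eqP => [kl|_]; last by rewrite scale0r scaler0.
by rewrite scalerA mulVf // scale1r (weight_proj_mod kl).
Qed.

Lemma sum_weight_proj : \sum_(k < n) e k = 1%:M.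
Proof.
rewrite -scaler_sumr exchange_big /= (bigD1 (Ordinal n_gt0)) //= [X in _ + X]big1 => [|j j0].
  under eq_bigr do rewrite mul0n expr0 scale1r.
  by rewrite sumr_const card_ord conj_mx1 addr0 -scaler_nat scalerA mulVf ?scale1r.
under eq_bigr do rewrite exprM.
rewrite -scaler_suml sum_root_unity; last first.
  by rewrite -exprM mulnC exprM (prim_expr_order z_prim) expr1n.
rewrite -(expr0 z) (eq_prim_root_expr z_prim) mod0n modn_small //.
by rewrite -[_ == _]/(j == Ordinal n_gt0) (negPf j0) scale0r.
Qed.

Lemma weight_proj_conj k : B *m e k *m B = e (k * s).
Proof.
rewrite -scalemxAr -scalemxAl mulmx_sumr mulmx_suml; congr (_ *: _).
(* Reindexing by [j |-> j * s], an involution modulo [n], lets conjugation by [b] return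
   [a ^+ (j * s)] to [a ^+ j]. *)
have inj : injective (@mul_s n s n_gt0).
  apply: (can_inj (g := @mul_s n s n_gt0)) => j; apply: val_inj => /=.
  by rewrite modnMml mul_s_s // modn_small.
rewrite (reindex_inj inj); apply: eq_bigr => j _ /=.
rewrite -scalemxAr -scalemxAl -!conj_mxM ?groupM ?groupX //; congr (_ *: rho _).
  by apply/eqP; rewrite (eq_prim_root_expr z_prim) modnMml mulnAC mulnA.
have bV : (b^-1 = b)%g by apply/eqP; rewrite eq_invg_mul bb.
rewrite -{1}bV -mulgA -conjgE conj_b; apply/eqP.
by rewrite eq_expg_mod_order oa modnMml mul_s_s.
Qed.

Lemma weight_proj_b k : B *m e k = e (k * s) *m B.
Proof. by rewrite -weight_proj_conj -[RHS]mulmxA conj_mx_bb mulmx1. Qed.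

(** The constant part of the centralizer orders gives a character sum over [<[a]>]; the extra [n] at
    multiples of [m] gives one with [tau] terms, nonzero exactly when [n] divides [m * k]. *)
Lemma mxtrace_weight_proj k :
  \tr (e k) = (if (n %| k)%N then n%:R else 0)
            + (if (tau %| k)%N then tau%:R else 0).
Proof.
rewrite mxtraceZ raddf_sum /= big_distrr /=.
under eq_bigr => j _.
  rewrite mxtraceZ mxtrace_conj_mx ?groupX // cent1_cycle natrD mulrDr mulrDr.
  rewrite mulrCA mulVf // mulr1; over.
rewrite big_split /=; congr (_ + _).
  under eq_bigr do rewrite mulnC exprM.
  rewrite sum_root_unity; last by rewrite -exprM mulnC exprM (prim_expr_order z_prim) expr1n.
  by rewrite -(expr0 z) (eq_prim_root_expr z_prim) mod0n.
transitivity (\sum_(j < n | (m %| j)%N) z ^+ (j * k)).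
  rewrite [RHS]big_mkcond; apply: eq_bigr => j _.
  by case: ifP => _; rewrite ?mulr0 // mulrCA mulVf ?mulr1.
rewrite (sum_dvdn_ord (fun j => z ^+ (j * k)) (cotau_gt0 s n_gt0) (tau_mul n s)).
under eq_bigr do rewrite -mulnA mulnC exprM.
rewrite sum_root_unity.
  rewrite -(expr0 z) (eq_prim_root_expr z_prim) mod0n -/(dvdn _ _).
  by rewrite -{1}(tau_mul n s) mulnC dvdn_pmul2l ?cotau_gt0.
rewrite -exprM mulnAC [(m * tau)%N]mulnC tau_mul // exprM.
by rewrite (prim_expr_order z_prim) expr1n.
Qed.

Lemma mxtrace_weight_proj_b k :
  \tr (e k *m B) = if (n %| k)%N then (2 * tau)%:R else 0.
Proof.
rewrite -scalemxAl mulmx_suml mxtraceZ raddf_sum /=.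
under eq_bigr => j _.
  rewrite -scalemxAl mxtraceZ -conj_mxM ?groupX // mxtrace_conj_mx ?groupM ?groupX //.
  rewrite cent1_cycle_b mulnC exprM; over.
rewrite -mulr_suml sum_root_unity; last by rewrite -exprM mulnC exprM (prim_expr_order z_prim) expr1n.
rewrite -(expr0 z) (eq_prim_root_expr z_prim) mod0n -/(dvdn _ _).
by case: ifP => _; rewrite ?mul0r ?mulr0 // mulrA mulVf // mul1r.
Qed.

Definition sign_proj (c : bool) : 'M[F]_#|G| := 2^-1 *: (1%:M + (-1) ^+ c *: B).
Local Notation h := sign_proj.

Let two_neq0 : 2 != 0 :> F. Proof. by rewrite pnatr_eq0. Qed.

Lemma sign_proj_bl c : B *m h c = (-1) ^+ c *: h c.
Proof.
rewrite -scalemxAr mulmxDr mulmx1 -scalemxAr conj_mx_bb scalerA mulrC -scalerA.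
congr (_ *: _); rewrite scalerDr scalerA -expr2 -exprM mulnC exprM sqrrN expr1n.
by rewrite expr1n scale1r addrC.
Qed.

Lemma sign_proj_br c : h c *m B = (-1) ^+ c *: h c.
Proof.
rewrite -sign_proj_bl /sign_proj -scalemxAl -scalemxAr; congr (_ *: _).
by rewrite mulmxDl mulmxDr mul1mx mulmx1 -scalemxAl -scalemxAr.
Qed.

Lemma sign_projM c d : h c *m h d = if c == d then h c else 0.
Proof.
rewrite {1}/sign_proj -scalemxAl mulmxDl mul1mx -scalemxAl sign_proj_bl scalerA.
rewrite -signr_addb -[X in X + _]scale1r -scalerDl scalerA.
case: eqP => [->|]; first by rewrite addbb -[1 + _]/(2%:R) mulVf // scale1r.
by case: c d => [] [] //= _; rewrite subrr mulr0 scale0r.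
Qed.

Lemma sum_sign_proj : h false + h true = 1%:M.
Proof.
rewrite -scalerDr scale1r scaleN1r addrACA subrr addr0 -mulr2n -scaler_nat.
by rewrite scalerA mulVf ?scale1r.
Qed.

Lemma weight_proj_central_b k : (m %| k)%N -> B *m e k = e k *m B.
Proof.
move=> mk; rewrite weight_proj_b; congr (_ *m _); apply: weight_proj_mod.
by apply/eqP; rewrite eqn_mod_mul_s.
Qed.

Lemma weight_sign_proj_comm c k : (m %| k)%N -> h c *m e k = e k *m h c.
Proof.
move=> mk; rewrite /sign_proj -[LHS]scalemxAl -[RHS]scalemxAr; congr (_ *: _).
rewrite mulmxDl mulmxDr mul1mx mulmx1; congr (_ + _).
by rewrite -[LHS]scalemxAl -[RHS]scalemxAr weight_proj_central_b.
Qed.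

Lemma weight_sign_projM k l c d : (m %| k)%N -> (m %| l)%N ->
  (e k *m h c) *m (e l *m h d)
  = if (k == l %[mod n]) && (c == d) then e k *m h c else 0.
Proof.
move=> mk ml; rewrite mulmxA -(mulmxA (e k)) weight_sign_proj_comm // !mulmxA.
rewrite weight_projM -mulmxA sign_projM.
by case: ifP; case: ifP; rewrite ?mul0mx ?mulmx0.
Qed.

(** Both sides are [w] times the block. This puts compressions of arbitrary [X] into the
    commutant. *)
Lemma scalar_block_comm (L E X : 'M[F]_#|G|) w :
  L *m E = w *: E -> E *m L = w *: E ->
  (E *m X *m E) *m L = L *m (E *m X *m E).
Proof.
by move=> LE EL; rewrite -mulmxA EL !mulmxA LE -scalemxAr -!scalemxAl.
Qed.

Lemma weight_block_comm k X :
  (e k *m X *m e k) *m rho a = rho a *m (e k *m X *m e k).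
Proof.
by apply: scalar_block_comm; rewrite ?weight_proj_comm weight_proj_mul.
Qed.

(** The factor 2 clears the [2^-1] of [sign_proj]. For [m %| k] the two projectors commute, so the
    product is idempotent and its rank is its trace. *)
Lemma weight_sign_trace c k : (m %| k)%N ->
  2 * (\rank (e k *m h c))%:R
  = (if (n %| k)%N then n%:R else 0) + (if (tau %| k)%N then tau%:R else 0)
    + (-1) ^+ c * (if (n %| k)%N then (2 * tau)%:R else 0) :> F.
Proof.
move=> mk; rewrite -mxtrace_idempotent; last first.
  by rewrite weight_sign_projM // !eqxx.
rewrite -scalemxAr mulmxDr mulmx1 -scalemxAr mxtraceZ mxtraceD mulVKf //.
by rewrite mxtrace_weight_proj mxtraceZ mxtrace_weight_proj_b.
Qed.

(** * The blocks, their ranks and the decomposition *)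

Section Blocks.
Variable K : {set 'I_n}.
Hypothesis K_repr : is_transversal K (kclasses n s) (krange n s).

(** The weights fixed by [b] are the multiples of [m], written [k * m] with [k < tau]; each one
    splits by sign. *)
Definition block_proj (i : block_index s K) : 'M[F]_#|G| :=
  match i with
  | inl (inl k) => e (k * m) *m h false
  | inl (inr k) => e (k * m) *m h true
  | inr k => e (val k)
  end.

Definition block_deg2 (i : block_index s K) : bool :=
  if i is inr _ then true else false.

Let cotau_mul (k : nat) : (m %| k * m)%N. Proof. exact: dvdn_mull. Qed.

Let cotau_mul_inj (k l : 'I_tau) : (k * m == l * m %[mod n]) = (k == l).
Proof.
by rewrite !modn_small ?eqn_pmul2r ?cotau_gt0 // -[X in (_ < X)%N](tau_mul n s)
  ltn_pmul2r ?cotau_gt0.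
Qed.

Let cotau_mul_neq (k : 'I_tau) l : l \in K -> (k * m == l %[mod n]) = false.
Proof.
move=> Kl; apply/negP=> /eqP kl; case/negP: (transversal_cotau K_repr Kl).
by rewrite /dvdn -(modn_dvdm _ (dvdn_cotau n s)) -kl modn_dvdm ?dvdn_cotau // -/(dvdn _ _).
Qed.

Lemma block_projM i j :
  block_proj i *m block_proj j = if i == j then block_proj i else 0.
Proof.
have hl (k : 'I_tau) c (l : {l | l \in K}) : e (k * m) *m h c *m e (val l) = 0.
  rewrite -weight_sign_proj_comm // -mulmxA weight_projM cotau_mul_neq ?mulmx0 //.
  exact: valP.
have lh (k : 'I_tau) c (l : {l | l \in K}) : e (val l) *m (e (k * m) *m h c) = 0.
  rewrite mulmxA weight_projM eq_sym cotau_mul_neq ?mul0mx //.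
  exact: valP.
case: i j => [[k|k]|k] [[l|l]|l] /=;
  rewrite ?weight_sign_projM ?cotau_mul_inj ?andbT ?andbF ?hl ?lh //.
by rewrite weight_projM !modn_small // (inj_eq val_inj).
Qed.

(** [b] preserves the fixed weights, all different from [l], and sends [l] to [l * s], which is
    congruent to no element of [K]. *)
Lemma block_proj_deg2 i j :
  block_deg2 j -> block_proj i *m B *m block_proj j = 0.
Proof.
case: j => // l _; have Kl := valP l.
have hl (k : 'I_tau) c : e (k * m) *m h c *m B *m e (val l) = 0.
  rewrite -weight_sign_proj_comm // -!mulmxA [e _ *m _]mulmxA.
  rewrite -weight_proj_central_b // -mulmxA weight_projM cotau_mul_neq //.
  by rewrite !mulmx0.
case: i => [[k|k]|k] //=.
rewrite -mulmxA weight_proj_b mulmxA weight_projM.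
by rewrite (negPf (transversal_mul_s n_gt0 s_gt0 s_sqr K_repr (valP k) Kl)) mul0mx.
Qed.

(** The two signs recombine to the fixed weights, while [k] and [k * s] for [k] in [K] cover the
    others: all weight projectors are summed. *)
Lemma sum_block_proj :
  \sum_i (block_proj i + if block_deg2 i then B *m block_proj i *m B else 0) = 1%:M.
Proof.
rewrite !big_sumType /= -big_split /=.
under eq_bigr do rewrite !addr0 -mulmxDr sum_sign_proj mulmx1.
rewrite -(sum_dvdn_ord e (cotau_gt0 s n_gt0) (tau_mul n s)).
under [X in _ + X]eq_bigr do rewrite weight_proj_conj.
pose f (k : 'I_n) : 'M[F]_#|G| := e k + e (k * s).
rewrite -(big_sub K f) -[RHS]sum_weight_proj [RHS](bigID (fun k : 'I_n => m %| k)%N) /=.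
congr (_ + _); transitivity (\sum_(k in krange n s) e k).
  rewrite (transversal_big n_gt0 s_gt0 s_sqr K_repr); apply: eq_bigr => k _.
  by congr (_ + _); apply: weight_proj_mod; rewrite /= modn_mod.
apply: eq_bigl => k; rewrite inE; case: k => [[|k] kn] //=.
by rewrite dvdn0.
Qed.

Lemma rank_block_proj i : \rank (block_proj i) = block_dim i.
Proof.
(* At weight [k * m] the conditions of the trace formula become those of [dim1] and [dim2]. *)
have nkm k : (n %| k * m)%N = (tau %| k)%N.
  by rewrite -{1}(tau_mul n s) dvdn_pmul2r ?cotau_gt0.
have tkm k : (tau %| k * m)%N = (tau ^ 2 %| n * k)%N.
  rewrite -mulnn -[X in (_ %| X * k)%N](tau_mul n s) -mulnA.
  by rewrite dvdn_pmul2l ?tau_gt0 // mulnC.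
have tn : (tau <= n)%N by rewrite dvdn_leq ?dvdn_gcdr.
have two_rank c k :
    (2 * \rank (e (k * m)%N *m h c))%:R
    = (if (tau %| k)%N then n%:R else 0)
      + (if (tau ^ 2 %| n * k)%N then tau%:R else 0)
      + (-1) ^+ c * (if (tau %| k)%N then (2 * tau)%:R else 0) :> F.
  by rewrite natrM weight_sign_trace // nkm tkm.
have tt k : (tau %| k)%N -> (tau ^ 2 %| n * k)%N.
  by rewrite -tkm; apply: dvdn_mulr.
case: i => [[k|k]|k] /=.
- have := two_rank false k; rewrite /dim1 expr0 mul1r; case: ifP => [tk|_].
    rewrite tt // -!natrD => /eqP; rewrite eqr_nat => /eqP e2.
    by rewrite -addnA -mulSn in e2; rewrite -e2 mulKn.
  by case: ifP => _; rewrite !addr0 ?add0r => /eqP;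
    rewrite ?(eqr_nat _ _ 0) ?eqr_nat => /eqP e2;
    rewrite -[LHS](mulKn _ (isT : 0 < 2)%N) e2.
- have := two_rank true k; rewrite /dim2 expr1 mulN1r; case: ifP => [tk|_].
    (* Twice the rank plus [2 * tau] is [n + tau]; as [tau <= n], the natural subtraction in [dim2]
       is not truncated. *)
    rewrite tt // => /eqP; rewrite eq_sym subr_eq -!natrD eqr_nat => /eqP e2.
    rewrite -[LHS](mulKn _ (isT : 0 < 2)%N); congr (_ %/ 2)%N.
    by apply: (@addIn (2 * tau)%N); rewrite -e2 mul2n -addnn addnA subnK.
  by case: ifP => _; rewrite oppr0 !addr0 ?add0r => /eqP;
    rewrite ?(eqr_nat _ _ 0) ?eqr_nat => /eqP e2;
    rewrite -[LHS](mulKn _ (isT : 0 < 2)%N) e2.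
apply/eqP; rewrite -(eqr_nat F) -mxtrace_idempotent ?weight_projM ?eqxx //.
rewrite mxtrace_weight_proj /dim3.
(* The term [n] of the trace cannot occur, as [m] divides [n] but not [k]. *)
case: ifP => [nk|_]; last by rewrite add0r; case: ifP.
case/negP: (transversal_cotau K_repr (valP k)).
exact: dvdn_trans (dvdn_cotau n s) nk.
Qed.

Lemma terwilliger_blocks :
  mx_isomorphic (terwilliger (F := F) (G := G)) (block_dim (n := n) (s := s) (K := K)).
Proof.
have e_comm A k : terwilliger (G := G) A -> A *m e k = e k *m A.
  move=> TA; rewrite -[LHS]scalemxAr -[RHS]scalemxAl; congr (_ *: _).
  rewrite mulmx_sumr mulmx_suml; apply: eq_bigr => j _.
  by rewrite -scalemxAr -scalemxAl terwilliger_comm ?groupX.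
have h_comm A c : terwilliger (G := G) A -> A *m h c = h c *m A.
  move=> TA; rewrite -[LHS]scalemxAr -[RHS]scalemxAl; congr (_ *: _).
  rewrite mulmxDr mulmxDl mulmx1 mul1mx -scalemxAr -scalemxAl.
  by rewrite terwilliger_comm.
have eh_comm A k c : terwilliger (G := G) A -> A *m (e k *m h c) = (e k *m h c) *m A.
  by move=> TA; rewrite mulmxA e_comm // -!mulmxA h_comm.
(* Both [rho a] and [B] act by scalars on the image of [e k *m h c]. *)
have T_eh k c X : (m %| k)%N -> terwilliger (G := G) ((e k *m h c) *m X *m (e k *m h c)).
  move=> mk; apply: terwilliger_comm_generators; apply: scalar_block_comm.
  - by rewrite mulmxA weight_proj_mul scalemxAl.
  - rewrite -weight_sign_proj_comm // -mulmxA weight_proj_comm weight_proj_mul.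
    by rewrite scalemxAr.
  - rewrite mulmxA weight_proj_central_b // -mulmxA sign_proj_bl.
    by rewrite scalemxAr.
  - by rewrite -mulmxA sign_proj_br scalemxAr.
apply: (mx_isomorphic_idempotents (e := block_proj) (b := B) (J := block_deg2)).
- exact: terwilliger_subalgebra.
- by move=> A TA; apply: terwilliger_comm.
- by move=> A [[k|k]|k] TA /=; rewrite ?eh_comm ?e_comm.
- by move=> [[k|k]|k] X //= _; apply: T_eh.
- move=> [//|k] X _ /=; apply: terwilliger_comm_generators.
    rewrite mulmxDl mulmxDr weight_block_comm; congr (_ + _).
    (* The conjugated copy is a block at weight [k * s], where [rho a] is again scalar. *)
    have -> : B *m (e (val k) *m X *m e (val k)) *m B
        = e (val k * s) *m (B *m X *m B) *m e (val k * s).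
      rewrite -!weight_proj_conj !mulmxA.
      by rewrite -(mulmxA _ B B) conj_mx_bb mulmx1 -(mulmxA _ B B) conj_mx_bb mulmx1.
    exact: weight_block_comm.
  (* Moving [B] across interchanges the two summands. *)
  rewrite mulmxDl mulmxDr !mulmxA conj_mx_bb mul1mx -(mulmxA _ B B) conj_mx_bb.
  by rewrite mulmx1 addrC.
- exact: block_projM.
- exact: block_proj_deg2.
- exact: sum_block_proj.
- exact: rank_block_proj.
Qed.
End Blocks.

End Metacyclic.

Theorem theorem4p1 (R : realType) (n s : nat)
    (gT : finGroupType) (G : {group gT}) (K : {set 'I_n})
    (n_ge3 : (3 <= n)%N) (s_ge1 : (1 <= s)%N)
    (s_sqr : (s ^ 2 = 1 %[mod n])%N) (s_neq1 : (s <> 1 %[mod n])%N)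
    (G_pres : (G \isog Grp (a : b : a ^+ n, b ^+ 2, b * a * b^-1 = a ^+ s))%g)
    (K_repr : is_transversal K (kclasses n s) (krange n s)) :
  mx_isomorphic (terwilliger (F := complex R) (G := G))
    (block_dim (n := n) (s := s) (K := K)).
Proof.
have n_gt1 : (1 < n)%N by apply: ltn_trans n_ge3.
have n_gt0 : (0 < n)%N := ltnW n_gt1.
have [a [b [[Ga Gb] oa nab [bb bab] oG]]] :=
  presentation_structure n_gt1 s_sqr s_neq1 G_pres.
have [|z z_prim] := @closed_field_prim_root (complex R) n.
  by rewrite pnatr_eq0 -lt0n.
exact: (terwilliger_blocks n_gt0 s_ge1 s_sqr Ga Gb oa nab bb bab oG z_prim K_repr).
Qed.
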